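(* Let $k$ be a field. Let $\mathcal T^{\mathrm{cl}}$ be the Ziegler topology on $\operatorname{Sp}\mathbb R$ and let $\mathcal T^{d_I}$ be the topology on $\operatorname{Sp}\mathbb R$ induced by the interleaving distance $d_I$. The restricted identity map $$\bigl(\operatorname{Sp}\mathbb R\setminus\{k_{\mathbb R}\},\ \mathcal T^{\mathrm{cl}}|_{\operatorname{Sp}\mathbb R\setminus\{k_{\mathbb R}\}}\bigr)\longrightarrow\bigl(\operatorname{Sp}\mathbb R,\ \mathcal T^{d_I}\bigr)$$ is continuous.
   Context: $\operatorname{Mod} k\mathbb R$ is the category of functors from the totally ordered set $\mathbb R$ (viewed as a category with a unique morphism $x\to y$ whenever $x\le y$) to $k$-vector spaces. For an interval $I\subseteq\mathbb R$, $k_I$ is the representation with value $k$ on $I$, $0$ elsewhere, and identity structure maps within $I$. $\operatorname{Sp}\mathbb R$ is the set of (representatives of) isomorphism classes of indecomposable injective objects of $\operatorname{Mod} k\mathbb R$; concretely $\operatorname{Sp}\mathbb R=\{k_{(-\infty,x)}\mid x\in\mathbb R\cup\{\infty\}\}\cup\{k_{(-\infty,y]}\mid y\in\mathbb R\}$, where $k_{(-\infty,\infty)}=k_{\mathbb R}$. Ziegler topology $\mathcal T^{\mathrm{cl}}$: let $\operatorname{mod} k\mathbb R$ be the (abelian) full subcategory of finitely presented objects, i.e. of those $M$ admitting an exact sequence $\bigoplus_{i=1}^m k_{[x_i,\infty)}\to\bigoplus_{j=1}^n k_{[y_j,\infty)}\to M\to0$. The topology is given by the Kuratowski closure operator $\mathcal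 U\mapsto({}^{\perp}\mathcal U)^{\perp}$, where ${}^{\perp}\mathcal U=\{C\in\operatorname{mod} k\mathbb R\mid\operatorname{Hom}(C,X)=0\text{ for all }X\in\mathcal U\}$ and $\mathcal C^{\perp}=\{X\in\operatorname{Sp}\mathbb R\mid\operatorname{Hom}(C,X)=0\text{ for all }C\in\mathcal C\}$. Interleaving distance: for $\varepsilon\in\mathbb R$ the shift functor is $M[\varepsilon](r)=M(r+\varepsilon)$, with the corresponding structure maps and the corresponding action on morphisms. For $\varepsilon\ge0$, $\mathrm{id}_M^{\varepsilon}\colon M\to M[\varepsilon]$ is the morphism given at $r$ by $M(r\le r+\varepsilon)$. An $\varepsilon$-interleaving between $M$ and $N$ is a pair of morphisms $\phi\colon M\to N[\varepsilon]$, $\psi\colon N\to M[\varepsilon]$ with $\psi[\varepsilon]\circ\phi=\mathrm{id}_M^{2\varepsilon}$ and $\phi[\varepsilon]\circ\psi=\mathrm{id}_N^{2\varepsilon}$. Then $d_I(M,N)=\inf\{\varepsilon\ge0\mid M\text{ and }N\text{ are }\varepsilon\text{-interleaved}\}$ (equal to $\infty$ if there is none); it is an extended pseudometric, and $\mathcal T^{d_I}$ is the topology with basis the open balls of $d_I$ in $\operatorname{Sp}\mathbb R$. *)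

(* Defs.v *)
From HB Require Import structures.
From mathcomp Require Import all_boot all_order all_algebra.
From mathcomp Require Import all_classical all_reals all_analysis.

Set Implicit Arguments.
Unset Strict Implicit.
Unset Printing Implicit Defensive.

Import Order.TTheory GRing.Theory Num.Theory.
Local Open Scope classical_set_scope.
Local Open Scope ring_scope.

(** * The category Mod kR *)

(* Functors from the poset R to k-vector spaces.  The order on R is boolean, so
   [r <= s] is proof-irrelevant and there is one structure map for r <= s. *)
Record pmod (k : fieldType) (R : realType) := PMod {
  pm_obj :> R -> lmodType k;
  pm_map : forall r s, r <= s -> pm_obj r -> pm_obj s;
  pm_linear : forall r s (h : r <= s), linear (pm_map h);
  pm_id : forall r (h : r <= r) v, pm_map h v = v;
  pm_comp : forall r s t (h : r <= s) (h' : s <= t) (h'' : r <= t) v,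
    pm_map h' (pm_map h v) = pm_map h'' v
}.

Record hom (k : fieldType) (R : realType) (M N : pmod k R) := Hom {
  hom_fun :> forall r, M r -> N r;
  hom_linear : forall r, linear (@hom_fun r);
  hom_nat : forall r s (h : r <= s) v,
    hom_fun (pm_map h v) = pm_map h (hom_fun v)
}.
Arguments hom_fun {k R M N} _ r v.
Arguments hom_linear {k R M N} _ r.

HB.instance Definition _ (k : fieldType) (R : realType) (M : pmod k R) r s
    (h : r <= s) :=
  GRing.isLinear.Build k (M r) (M s) *:%R (@pm_map k R M r s h)
    (pm_linear h).

HB.instance Definition _ (k : fieldType) (R : realType) (M N : pmod k R)
    (f : hom M N) r :=
  GRing.isLinear.Build k (M r) (N r) *:%R (hom_fun f r) (hom_linear f r).

Definition hom_eq0 (k : fieldType) (R : realType) (M N : pmod k R) : Prop :=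
  forall (f : hom M N) r (v : M r), f r v = 0.

(** * Interval representations *)

Section IntervalModule.
Variables (k : fieldType) (R : realType).

Definition fib (b : bool) : lmodType k :=
  if b return lmodType k then k^o else 'rV[k]_0.

Definition fib_map (b c : bool) : fib b -> fib c :=
  match b, c return fib b -> fib c with
  | true, true => idfun
  | _, _ => fun=> 0
  end.

Lemma fib_map_linear b c : linear (@fib_map b c).
Proof. by case: b c => [] [] a u v /=; rewrite ?scaler0 ?addr0. Qed.

Lemma fib_map_id b v : @fib_map b b v = v.
Proof. by case: b v => //= v; rewrite [v]thinmx0. Qed.

Lemma fib0 (v : fib false) : v = 0.
Proof. exact: thinmx0. Qed.

Lemma fib_map_comp (b c d : bool) v : (b -> d -> c) ->
  @fib_map c d (@fib_map b c v) = @fib_map b d v.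
Proof. by case: b c d v => [] [] [] // v /(_ isT isT). Qed.

Lemma mem_itv_convex (i : interval R) r s t :
  r <= s -> s <= t -> r \in i -> t \in i -> s \in i.
Proof.
move=> rs st; case: i => a b; rewrite !itv_boundlr => /andP[ar _] /andP[_ tb].
by rewrite (le_trans ar) ?bnd_simp//= (le_trans _ tb)// bnd_simp.
Qed.

(* k_I *)
Definition kint (i : interval R) : pmod k R.
Proof.
refine (@PMod k R (fun r => fib (r \in i))
  (fun r s _ => @fib_map (r \in i) (s \in i)) _ _ _).
- by move=> r s _; exact: fib_map_linear.
- by move=> r _ v; exact: fib_map_id.
- move=> r s t rs st _ v; apply: fib_map_comp.
  exact: mem_itv_convex rs st.
Defined.

(** * Finitely presented representations *)

Definition pzero : pmod k R.
Proof.
by refine (@PMod k R (fun=> fib false) (fun _ _ _ v => v) _ _ _).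
Defined.

Definition pprod (M N : pmod k R) : pmod k R.
Proof.
refine (@PMod k R (fun r => (M r * N r)%type)
  (fun r s h v => (pm_map h v.1, pm_map h v.2)) _ _ _).
- by move=> r s h a u v; rewrite /= !linearP.
- by move=> r h [u v] /=; rewrite !pm_id.
- by move=> r s t h h' h'' [u v] /=; rewrite !(pm_comp h h' h'').
Defined.

(* the direct sum of the k_[x, oo) for x in xs *)
Definition pfree (xs : seq R) : pmod k R :=
  foldr (fun x M => pprod (kint `[x, +oo[) M) pzero xs.

Definition finitely_presented (C : pmod k R) : Prop :=
  exists (xs ys : seq R) (f : hom (pfree xs) (pfree ys)) (g : hom (pfree ys) C),
    (forall r (v : pfree ys r), g r v = 0 <-> exists u, v = f r u) /\
    (forall r (c : C r), exists v, c = g r v).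

End IntervalModule.

(** * The spectrum *)

(* Representatives of the isomorphism classes of indecomposable injective
   objects of Mod kR: [SpLt x], [SpLe y] and [SpFull] stand for k_(-oo,x),
   k_(-oo,y] and k_R = k_(-oo,oo). *)
Inductive Sp (R : realType) := SpLt of R | SpLe of R | SpFull.
Arguments SpFull {R}.

HB.instance Definition _ (R : realType) := gen_eqMixin (Sp R).
HB.instance Definition _ (R : realType) := gen_choiceMixin (Sp R).

Definition Sp_itv (R : realType) (X : Sp R) : interval R :=
  match X with
  | SpLt x => `]-oo, x[
  | SpLe y => `]-oo, y]
  | SpFull => `]-oo, +oo[
  end.

Definition Sp_mod (k : fieldType) (R : realType) (X : Sp R) : pmod k R :=
  kint k (Sp_itv X).

(* Copies of the spectrum, to carry its two topologies. *)
Definition Ziegler (k : fieldType) (R : realType) : Type := Sp R.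
Definition Interleaving (k : fieldType) (R : realType) : Type := Sp R.

(** * The Ziegler topology *)

Section ZieglerTopology.
Variables (k : fieldType) (R : realType).

(* Full subcategories of Mod kR are predicates rather than [set]s because
   [pmod k R] is too large for the universe of [set]. *)
Definition lperp (U : set (Sp R)) : pmod k R -> Prop :=
  fun C => finitely_presented C /\ forall X, U X -> hom_eq0 C (Sp_mod k X).

Definition rperp (CC : pmod k R -> Prop) : set (Sp R) :=
  [set X | forall C, CC C -> hom_eq0 C (Sp_mod k X)].

Definition ziegler_cl (U : set (Sp R)) : set (Sp R) := rperp (lperp U).

Definition ziegler_open (U : set (Sp R)) : Prop :=
  ziegler_cl (~` U) = ~` U.

(** ** [ziegler_cl] is a Kuratowski closure operator *)

Lemma ziegler_cl_sub U : U `<=` ziegler_cl U.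
Proof. by move=> X UX C [_]; apply. Qed.

Lemma ziegler_clS U V : U `<=` V -> ziegler_cl U `<=` ziegler_cl V.
Proof. by move=> UV X h C [fC hC]; apply: h; split=> // Y /UV; exact: hC. Qed.

Lemma ziegler_cl_idem U : ziegler_cl (ziegler_cl U) = ziegler_cl U.
Proof.
apply/seteqP; split; last exact: ziegler_cl_sub.
by move=> X h C [fC hC]; apply: h; split=> // Y; apply.
Qed.

Definition Sp_bound (X : Sp R) : itv_bound R :=
  match X with SpLt x => BLeft x | SpLe y => BRight y | SpFull => +oo%O end.

Lemma Sp_itvE X : Sp_itv X = Interval -oo%O (Sp_bound X).
Proof. by case: X. Qed.

Lemma in_Sp (r : R) X : (r \in Sp_itv X) = (BRight r <= Sp_bound X)%O.
Proof. by rewrite Sp_itvE itv_boundlr. Qed.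

Lemma Sp_down (r s : R) X : r <= s -> s \in Sp_itv X -> r \in Sp_itv X.
Proof. by rewrite !in_Sp => rs; apply: le_trans; rewrite bnd_simp. Qed.

Lemma fib_map_ne0 (b c : bool) (v : fib k b) : c -> v != 0 -> fib_map c v != 0.
Proof.
by case: b c v => [] [] // v _; rewrite (fib0 v) eqxx.
Qed.

Lemma fib_ne0 b (v : fib k b) : v != 0 -> b.
Proof. by case: b v => // v; rewrite (fib0 v) eqxx. Qed.

Lemma fib_eq (b : bool) (u v : fib k b) : ~~ b -> u = v.
Proof. by case: b u v => // u v _; rewrite (fib0 u) (fib0 v). Qed.

Lemma hom_comp_linear (M N P : pmod k R) (g : hom N P) (f : hom M N) r :
  linear (fun v => g r (f r v)).
Proof. by move=> a u v; rewrite !linearP. Qed.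

Definition hom_comp (M N P : pmod k R) (g : hom N P) (f : hom M N) : hom M P.
Proof.
refine (@Hom k R M P (fun r v => g r (f r v)) (hom_comp_linear g f) _).
by move=> r s h v; rewrite !hom_nat.
Defined.

Lemma kint_hom (i j : interval R) :
  (forall r s, r <= s -> r \in i -> s \in j -> (r \in j) /\ (s \in i)) ->
  exists f : hom (kint k i) (kint k j),
    forall r v, f r v = fib_map (r \in j) v.
Proof.
move=> ij.
suff nat r s (h : r <= s) (v : kint k i r) :
    @fib_map k (s \in i) (s \in j) (pm_map h v) =
    pm_map h (@fib_map k (r \in i) (r \in j) v : kint k j r).
  by exists (@Hom k R (kint k i) (kint k j)
    (fun r => @fib_map k (r \in i) (r \in j))
    (fun r => @fib_map_linear k _ _) nat).
by rewrite /= !fib_map_comp// => ri sj; have [] := ij r s h ri sj.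
Qed.

Lemma fp_kint_right (a x : R) : a < x ->
  finitely_presented (kint k `[a, x[).
Proof.
move=> ax.
have [f fE] : exists f : hom (kint k `[x, +oo[) (kint k `[a, +oo[),
    forall r v, f r v = fib_map (r \in `[a, +oo[) v.
  apply: kint_hom => r s rs; rewrite !in_itv/= !andbT => xr _.
  by split; [exact: (le_trans (ltW ax)) | exact: le_trans rs].
have [g gE] : exists g : hom (kint k `[a, +oo[) (kint k `[a, x[),
    forall r v, g r v = fib_map (r \in `[a, x[) v.
  apply: kint_hom => r s rs; rewrite !in_itv/= !andbT => ar /andP[-> sx].
  by rewrite ar (le_lt_trans rs sx).
have lf r : linear (fun u : pfree k [:: x] r => (f r u.1, 0) : pfree k [:: a] r).
  move=> b u v; congr pair; first by rewrite linearP.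
  by rewrite [RHS]fib0.
have lg r : linear (fun u : pfree k [:: a] r => g r u.1).
  by move=> b u v; rewrite linearP.
have nf r s (h : r <= s) (v : pfree k [:: x] r) :
    (f s (pm_map h v).1, 0) = pm_map h ((f r v.1, 0) : pfree k [:: a] r).
  by congr pair; rewrite -hom_nat.
have ng r s (h : r <= s) (v : pfree k [:: a] r) :
    g s (pm_map h v).1 = pm_map h (g r v.1).
  by rewrite -hom_nat.
exists [:: x], [:: a], (Hom lf nf), (Hom lg ng); split => r.
- move=> [v w] /=; rewrite (fib0 w) gE.
  have e1 : (r \in `[a, x[) = (r \in `[a, +oo[) && ~~ (r \in `[x, +oo[).
    by rewrite !in_itv/= !andbT -ltNge.
  have e2 : (r \in `[x, +oo[) -> (r \in `[a, +oo[).
    by rewrite !in_itv/= !andbT; apply: le_trans; exact: ltW.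
  split=> [|[[u u'] [->]]]; last first.
    rewrite fE; move: u; rewrite /= {}e1.
    by case: (r \in `[x, +oo[) => u; case: (r \in `[a, +oo[) => //=.
  suff: fib_map (r \in `[a, x[) v = 0 ->
      exists u, v = @fib_map k (r \in `[x, +oo[) (r \in `[a, +oo[) u.
    by move=> /[apply] -[u ->]; exists (u, 0); rewrite /= fE.
  clear w gE; move: v; rewrite /= {}e1.
  case: (r \in `[x, +oo[) e2 => [/(_ isT)|_].
    by case: (r \in `[a, +oo[) => // _ v _; exists v.
  case: (r \in `[a, +oo[) => v; first by move=> /= ->; exists 0.
  by exists 0; rewrite (fib0 v).
- move=> c; exists ((@fib_map k (r \in `[a, x[) (r \in `[a, +oo[) c), 0) => /=.
  rewrite gE; move: c => /=.
  have: (r \in `[a, x[) -> (r \in `[a, +oo[).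
    by rewrite !in_itv/= => /andP[->].
  case: (r \in `[a, x[) => [/(_ isT) ->//|_ c].
  by rewrite (fib0 c) [RHS]fib0.
Qed.

Lemma fp_kint_pinfty (a : R) : finitely_presented (kint k `[a, +oo[).
Proof.
have lf r : linear (fun u : pfree k [::] r => 0 : pfree k [:: a] r).
  by move=> b u v; rewrite scaler0 addr0.
have lg r : linear (fun u : pfree k [:: a] r => u.1 : kint k `[a, +oo[ r).
  by move=> b u v.
have nf r s (h : r <= s) (v : pfree k [::] r) :
    0 = pm_map h (0 : pfree k [:: a] r) by rewrite linear0.
have ng r s (h : r <= s) (v : pfree k [:: a] r) :
    (pm_map h v).1 = pm_map h (v.1 : kint k `[a, +oo[ r) by [].
exists [::], [:: a], (Hom lf nf), (Hom lg ng); split => r.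
- move=> [v w] /=; split=> [->|[_ [->]]//].
  by exists 0; rewrite (fib0 w).
- by move=> c; exists (c, 0).
Qed.

(* the bounds b such that [a, b) is a half-open interval *)
Definition bnd_right (b : itv_bound R) : bool :=
  match b with BSide b _ => b | BInfty b => ~~ b end.

Lemma fp_kint (a : R) b : bnd_right b -> (BLeft a < b)%O ->
  finitely_presented (kint k (Interval (BLeft a) b)).
Proof.
case: b => [[] x //|[]//] _; last by move=> _; exact: fp_kint_pinfty.
by rewrite bnd_simp; exact: fp_kint_right.
Qed.

Lemma hom_kint_Sp (a : R) b X : a \in Sp_itv X -> (Sp_bound X <= b)%O ->
  ~ hom_eq0 (kint k (Interval (BLeft a) b)) (Sp_mod k X).
Proof.
move=> aX Xb.
have ai : a \in Interval (BLeft a) b.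
  by rewrite itv_boundlr lexx/= (le_trans _ Xb)// -in_Sp.
have [f fE] : exists f : hom (kint k (Interval (BLeft a) b)) (Sp_mod k X),
    forall r v, f r v = fib_map (r \in Sp_itv X) v.
  apply: kint_hom => r s rs ri sX; split; first exact: Sp_down sX.
  move: ri; rewrite !itv_boundlr => /andP[ar _].
  rewrite (le_trans ar) ?bnd_simp//=.
  by apply: le_trans Xb; rewrite -in_Sp.
move=> h0; have v : {v : kint k (Interval (BLeft a) b) a | v != 0}.
  by rewrite /= ai; exists 1; exact: oner_neq0.
by case: v => v /(fib_map_ne0 aX); rewrite -fE h0 eqxx.
Qed.

Lemma itv_boundx1 (b : itv_bound R) : (b <= +oo)%O.
Proof. by case: b => [[]|[]]. Qed.

Lemma hom_kint_SpP (a : R) b X : bnd_right b ->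
  ~ hom_eq0 (kint k (Interval (BLeft a) b)) (Sp_mod k X) ->
  a \in Sp_itv X /\ (Sp_bound X <= b)%O.
Proof.
move=> br; apply: contra_notP => nh f s v; apply/eqP/negPn/negP => fv0.
have sX := fib_ne0 fv0.
have /fib_ne0 si : (v : fib k _) != 0.
  by apply: contra_neq fv0 => ->; rewrite linear0.
have as_ : a <= s by move: si; rewrite itv_boundlr bnd_simp => /andP[].
apply: nh; split; first exact: Sp_down sX.
rewrite leNgt; apply/negP => bX.
case: b br f v fv0 si bX => [[] t|[]]// _ f v fv0 si bX.
have st : s <= t by move: si; rewrite in_itv/= => /andP[_ /ltW].
have tX : t \in Sp_itv X.
  by rewrite in_Sp; case: (X) bX => //= x; rewrite !bnd_simp.
have : pm_map st (f s v) != 0 by apply: (fib_map_ne0 tX fv0).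
rewrite -hom_nat.
suff -> : pm_map st v = 0 by rewrite linear0 eqxx.
apply/eqP/negPn/negP => /fib_ne0.
by rewrite in_itv/= ltxx andbF.
Qed.

(* M(y <= u) is bijective for all u >= y close to y *)
Definition right_constant (M : pmod k R) (y : R) (t : R) : Prop :=
  forall u (h : y <= u), u < t ->
    (forall v, pm_map h v = 0 :> M u -> v = 0) /\
    (forall w : M u, exists v, w = pm_map h v).

Lemma right_constant_free xs y : exists2 t, y < t &
  right_constant (pfree k xs) y t.
Proof.
elim: xs => [|x xs [t yt tP]].
  exists (y + 1); first by rewrite ltrDl.
  by move=> u h _; split=> // w; exists w.
have [t' [yt' t't xP]] : exists t', [/\ y < t', t' <= t &
    forall u, y <= u -> u < t' -> (y \in `[x, +oo[) = (u \in `[x, +oo[)].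
  case: (leP x y) => xy.
    exists t; split=> // u yu _.
    by rewrite !in_itv/= !andbT xy (le_trans xy yu).
  exists (Num.min x t); split; rewrite ?lt_min ?xy ?yt ?ge_min ?lexx ?orbT//.
  move=> u yu; rewrite lt_min => /andP[ux _].
  by rewrite !in_itv/= !andbT !leNgt xy ux.
exists t' => // u h ut'.
have [inj sur] := tP u h (lt_le_trans ut' t't).
have e := xP u h ut'; split.
- move=> [v w] [+ /inj ->] => v0; congr pair.
  move: v v0 => /=; rewrite e => v.
  by rewrite fib_map_id.
- move=> [w1 w2]; have [v2 ->] := sur w2.
  exists (@fib_map k (u \in `[x, +oo[) (y \in `[x, +oo[) w1, v2).
  congr pair; move: w1 => /=; rewrite e => w1.
  by rewrite !fib_map_id.
Qed.

Lemma right_constant_fp C y : finitely_presented C ->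
  exists2 t, y < t & right_constant C y t.
Proof.
move=> [xs [ys [f [g [ex sur]]]]].
have [t1 yt1 P1] := right_constant_free xs y.
have [t2 yt2 P2] := right_constant_free ys y.
exists (Num.min t1 t2); first by rewrite lt_min yt1.
move=> u h; rewrite lt_min => /andP[ut1 ut2].
have [_ s1] := P1 u h ut1; have [i2 s2] := P2 u h ut2; split.
- move=> v; have [w ->] := sur _ v; rewrite -hom_nat => /ex[w'].
  have [z ->] := s1 w'; rewrite hom_nat => /eqP; rewrite -subr_eq0 -linearB.
  move=> /eqP/i2/eqP; rewrite subr_eq0 => /eqP ->.
  by apply/ex; exists z.
- move=> c; have [w ->] := sur _ c; have [v ->] := s2 w.
  by exists (g y v); rewrite hom_nat.
Qed.

(* an extension to k_E of a morphism to k_(-oo,y] *)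
Lemma hom_extend C (y t : R) E (f : hom C (Sp_mod k (SpLe y))) r v :
  right_constant C y t -> y \in Sp_itv E -> (Sp_bound E <= BLeft t)%O ->
  f r v != 0 -> ~ hom_eq0 C (Sp_mod k E).
Proof.
move=> rc yE Et fv0.
have yt : y < t.
  by move: yE; rewrite in_Sp => /le_trans/(_ Et); rewrite bnd_simp.
pose mx s := Num.max s y.
have sm s : s <= mx s by rewrite le_max lexx.
have ym s : y <= mx s by rewrite le_max lexx orbT.
pose P s (v : C s) w := pm_map (sm s) v = pm_map (ym s) w.
have mxt s : s \in Sp_itv E -> mx s < t.
  rewrite in_Sp => /le_trans/(_ Et); rewrite bnd_simp /= => st.
  by rewrite gt_max st.
have Pex s (u : C s) : exists w, s \in Sp_itv E -> P s u w.
  case: (boolP (s \in Sp_itv E)) => [sE|]; last by exists 0.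
  by have [_ /(_ (pm_map (sm s) u))[w wE]] := rc _ (ym s) (mxt _ sE); exists w.
have Puniq s (u : C s) w w' : s \in Sp_itv E -> P s u w -> P s u w' -> w = w'.
  rewrite /P => sE -> /eqP; rewrite -subr_eq0 -linearB => /eqP ww.
  have [/(_ _ ww)/eqP + _] := rc _ (ym s) (mxt _ sE).
  by rewrite subr_eq0 => /eqP.
pose W s (u : C s) := projT1 (cid (Pex s u)).
have WP s (u : C s) : s \in Sp_itv E -> P s u (W s u).
  by rewrite /W; case: cid.
pose h s (u : C s) : Sp_mod k E s :=
  @fib_map k (y \in Sp_itv (SpLe y)) (s \in Sp_itv E) (f y (W s u)).
have hl s : linear (h s).
  move=> a u u'; rewrite /h.
  case/orP: (orbN (s \in Sp_itv E)) => sE; last first.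
    exact (@fib_eq (s \in Sp_itv E) _ _ sE).
  have -> : W s (a *: u + u') = a *: W s u + W s u'.
    apply: (Puniq s (a *: u + u')) => //; first exact: WP.
    by rewrite /P !linearP /= (WP s u sE) (WP s u' sE).
  by rewrite hom_linear; exact: fib_map_linear.
have hn s s' (ss' : s <= s') (u : C s) :
    h s' (pm_map ss' u) = pm_map ss' (h s u).
  case/orP: (orbN (s' \in Sp_itv E)) => s'E; last first.
    exact (@fib_eq (s' \in Sp_itv E) _ _ s'E).
  have sE := Sp_down ss' s'E.
  rewrite /h /= fib_map_comp//; congr (fib_map _ (f y _)).
  apply: (Puniq s' (pm_map ss' u)) => //; first exact: WP.
  have mm : mx s <= mx s' by rewrite ge_max !le_max ss' lexx orbT.
  have sm' : s <= mx s' by rewrite (le_trans (sm s) mm).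
  rewrite /P (pm_comp _ _ sm') -(pm_comp (sm s) mm) (WP s u sE).
  by rewrite (pm_comp _ _ (ym s')).
move=> /(_ (Hom hl hn) r v) /= /eqP; apply/negP.
have ry : r <= y by have := fib_ne0 fv0; rewrite in_itv.
have rE := Sp_down ry yE.
rewrite /h; apply: fib_map_ne0 => //.
have -> : W r v = pm_map ry v.
  apply: (Puniq r v) => //; first exact: WP.
  by rewrite /P (pm_comp _ _ (sm r)).
by rewrite hom_nat; apply: fib_map_ne0 => //; rewrite in_itv/=.
Qed.

Lemma hom_restrict C X Y (f : hom C (Sp_mod k X)) r v :
  f r v != 0 -> r \in Sp_itv Y -> (Sp_bound Y <= Sp_bound X)%O ->
  ~ hom_eq0 C (Sp_mod k Y).
Proof.
move=> fv0 rY YX.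
have [g gE] : exists g : hom (Sp_mod k X) (Sp_mod k Y),
    forall r v, g r v = fib_map (r \in Sp_itv Y) v.
  apply: kint_hom => u s us uX sY; split; first exact: Sp_down sY.
  by rewrite in_Sp (le_trans _ YX)// -in_Sp.
move=> /(_ (hom_comp g f) r v) /= /eqP; apply/negP.
by rewrite gE; exact: fib_map_ne0.
Qed.

Lemma ziegler_nbhs C X : finitely_presented C -> ~ hom_eq0 C (Sp_mod k X) ->
  exists r b, [/\ bnd_right b, r \in Sp_itv X, (Sp_bound X <= b)%O &
    forall Y, r \in Sp_itv Y -> (Sp_bound Y <= b)%O ->
      ~ hom_eq0 C (Sp_mod k Y)].
Proof.
move=> fpC /existsNP[f /existsNP[r /existsNP[v /eqP fv0]]].
have rX := fib_ne0 fv0; exists r.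
have [bX|] := boolP (bnd_right (Sp_bound X)).
  by exists (Sp_bound X); split=> // Y rY YX; exact: hom_restrict fv0 rY YX.
case: X f fv0 rX => // y f fv0 rX _.
have [t yt rc] := right_constant_fp y fpC.
exists (BLeft t); split; rewrite ?bnd_simp// => Y rY Yt.
have [YX|XY] := leP (Sp_bound Y) (Sp_bound (SpLe y)).
  exact: hom_restrict fv0 rY YX.
by apply: (hom_extend rc _ Yt fv0); rewrite in_Sp; exact: ltW.
Qed.

Lemma ziegler_openP U : ziegler_open U <->
  forall X, U X -> exists2 C, lperp (~` U) C & ~ hom_eq0 C (Sp_mod k X).
Proof.
split=> [oU X UX|oU].
  have : ~ ziegler_cl (~` U) X by rewrite oU => /(_ UX).
  by move=> /existsNP[C /not_implyP[CU CX]]; exists C.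
apply/seteqP; split; last exact: ziegler_cl_sub.
by move=> X clX /oU[C /clX].
Qed.

Lemma ziegler_openT : ziegler_open setT.
Proof.
apply/ziegler_openP => X _.
have [a aX] : exists a, a \in Sp_itv X.
  by case: X => [x|x|]; [exists (x - 1)|exists x|exists 0];
    rewrite in_itv/= ?ltrBlDr ?ltrDl ?lexx.
exists (kint k `[a, +oo[); last by apply: hom_kint_Sp => //; exact: itv_boundx1.
by rewrite /lperp setCT; split=> //; exact: fp_kint_pinfty.
Qed.

Lemma ziegler_openI : setI_closed ziegler_open.
Proof.
move=> U V /ziegler_openP oU /ziegler_openP oV; apply/ziegler_openP => X [UX VX].
have [C [fC CU] CX] := oU X UX; have [D [fD DV] DX] := oV X VX.
have [r [b [br rX Xb hC]]] := ziegler_nbhs fC CX.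
have [s [c [cr sX Xc hD]]] := ziegler_nbhs fD DX.
pose m := Num.max r s; pose d := Order.min b c.
have dr : bnd_right d by rewrite /d; case: leP.
have Xd : (Sp_bound X <= d)%O by rewrite le_min Xb.
have mX : m \in Sp_itv X by rewrite /m; case: leP.
exists (kint k (Interval (BLeft m) d)); last exact: hom_kint_Sp.
split.
  apply: fp_kint => //; apply: lt_le_trans Xd.
  by move: mX; rewrite in_Sp; apply: lt_le_trans; rewrite bnd_simp.
move=> Y; apply: contra_notP => /(hom_kint_SpP dr)[mY].
rewrite le_min => /andP[Yb Yc]; split.
  apply: contrapT => /CU; apply: hC => //; apply: Sp_down mY.
  by rewrite le_max lexx.
apply: contrapT => /DV; apply: hD => //; apply: Sp_down mY.
by rewrite le_max lexx orbT.
Qed.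

Lemma ziegler_open_bigU (I : Type) (U : I -> set (Sp R)) :
  (forall i, ziegler_open (U i)) -> ziegler_open (\bigcup_i U i).
Proof.
move=> oU; apply/ziegler_openP => X [i _ UX].
have /ziegler_openP/(_ X UX)[C [fC CU] CX] := oU i.
by exists C => //; split=> // Y nY; apply: CU => UY; apply: nY; exists i.
Qed.

HB.instance Definition _ := Choice.on (Ziegler k R).
HB.instance Definition _ := isOpenTopological.Build (Ziegler k R)
  ziegler_openT ziegler_openI ziegler_open_bigU.

End ZieglerTopology.

(** * The interleaving distance *)

Section InterleavingDistance.
Variables (k : fieldType) (R : realType).

Lemma shift_le (e r s : R) : r <= s -> r + e <= s + e.
Proof. by rewrite lerD2r. Qed.

(* M[e] *)
Definition shift (e : R) (M : pmod k R) : pmod k R.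
Proof.
refine (@PMod k R (fun r => M (r + e))
  (fun r s h => @pm_map k R M _ _ (shift_le e h)) _ _ _).
- by move=> r s h; exact: pm_linear.
- by move=> r h v; exact: pm_id.
- by move=> r s t h h' h'' v; exact: pm_comp.
Defined.

Definition shift_hom (e : R) (M N : pmod k R) (f : hom M N) :
  hom (shift e M) (shift e N).
Proof.
refine (@Hom k R (shift e M) (shift e N) (fun r => f (r + e)) _ _).
- by move=> r; exact (hom_linear f (r + e)).
- by move=> r s h v; exact (hom_nat f (shift_le e h) v).
Defined.

(* The equations read psi[e] o phi = id_M^(2e) and phi[e] o psi = id_N^(2e),
   with M[e][e] in place of M[2e]: at r, both sides take values in
   M (r + e + e), and id_M^(2e) is the structure map along r <= r + e + e. *)
Definition interleaving (e : R) (M N : pmod k R)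
    (phi : hom M (shift e N)) (psi : hom N (shift e M)) : Prop :=
  (forall r (h : r <= r + e + e) (v : M r),
     hom_comp (shift_hom e psi) phi r v = pm_map h v) /\
  (forall r (h : r <= r + e + e) (v : N r),
     hom_comp (shift_hom e phi) psi r v = pm_map h v).

Definition interleaved (e : R) (M N : pmod k R) : Prop :=
  exists phi psi, @interleaving e M N phi psi.

Definition d_I (M N : pmod k R) : \bar R :=
  ereal_inf [set e%:E | e in [set e : R | 0 <= e /\ interleaved e M N]].

(** ** [d_I] is an extended pseudometric *)

Lemma interleaved_refl M : interleaved 0 M M.
Proof.
have le0 (r : R) : r <= r + 0 by rewrite addr0.
have l r : linear (fun v : M r => pm_map (le0 r) v : shift 0 M r).
  by move=> a u v; rewrite linearP.
have n r s (h : r <= s) (v : M r) : (pm_map (le0 s) (pm_map h v) : shift 0 M s)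
    = pm_map h (pm_map (le0 r) v : shift 0 M r).
  have h' : r <= s + 0 by rewrite addr0.
  by rewrite (pm_comp _ _ h') /= (pm_comp _ _ h').
exists (Hom l n), (Hom l n); split=> r h v /=;
  by rewrite (pm_comp _ _ h).
Qed.

Lemma interleaved_sym e M N : interleaved e M N -> interleaved e N M.
Proof. by move=> [phi [psi [h1 h2]]]; exists psi, phi. Qed.

Lemma hom_shift_comp (e1 e2 e : R) (M N P : pmod k R)
    (f : hom M (shift e1 N)) (g : hom N (shift e2 P)) :
  e1 + e2 = e -> exists phi : hom M (shift e P),
    forall r (h : r + e1 + e2 <= r + e) v,
      phi r v = pm_map h (g (r + e1) (f r v)).
Proof.
move=> e12; have le12 r : r + e1 + e2 <= r + e by rewrite -addrA e12.
pose phi r (v : M r) : shift e P r := pm_map (le12 r) (g (r + e1) (f r v)).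
have l r : linear (phi r).
  move=> a u v; rewrite /phi (hom_linear f) (hom_linear g).
  exact (pm_linear (le12 r) a _ _).
have n r s (h : r <= s) (v : M r) : phi s (pm_map h v) = pm_map h (phi r v).
  rewrite /phi (hom_nat f) /= (hom_nat g) /=.
  have h' : r + e1 + e2 <= s + e by rewrite (le_trans (le12 r))// lerD2r.
  by rewrite (pm_comp _ _ h') (pm_comp _ _ h').
exists (Hom l n) => r h v /=; rewrite /phi.
by congr (pm_map _ _); exact: bool_irrelevance.
Qed.

Lemma interleaving_comp (e1 e2 e : R) (M N P : pmod k R)
    (f : hom M (shift e1 N)) (g : hom N (shift e1 M))
    (f' : hom N (shift e2 P)) (g' : hom P (shift e2 N))
    (phi : hom M (shift e P)) (psi : hom P (shift e M)) :
  0 <= e1 -> 0 <= e2 -> e = e1 + e2 ->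
  interleaving f g -> interleaving f' g' ->
  (forall r (h : r + e1 + e2 <= r + e) v,
      phi r v = pm_map h (f' (r + e1) (f r v))) ->
  (forall r (h : r + e2 + e1 <= r + e) v,
      psi r v = pm_map h (g (r + e2) (g' r v))) ->
  forall r (h : r <= r + e + e) v, psi (r + e) (phi r v) = pm_map h v.
Proof.
move=> e10 e20 eE [gf _] [gf' _] phiE psiE r h v.
have h1 : r + e1 + e2 <= r + e by rewrite eE addrA.
have h2 : r + e + e2 + e1 <= r + e + e by rewrite eE -(addrA _ e2) (addrC e2).
have h3 : r + e1 <= r + e1 + e2 + e2 by rewrite -addrA lerDl addr_ge0.
have h4 : r + e1 <= r + e + e2 by rewrite (le_trans h3)// lerD2r.
have h5 : r <= r + e1 + e1 by rewrite -addrA lerDl addr_ge0.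
have h6 : r <= r + e + e2 + e1.
  by rewrite eE -2!addrA lerDl !addr_ge0.
rewrite (phiE _ h1) (psiE _ h2) (hom_nat g') /=.
move: (gf' _ h3 (f r v)) => /= ->.
rewrite (pm_comp _ _ h4) (hom_nat g) /=.
move: (gf _ h5 v) => /= ->.
by rewrite (pm_comp _ _ h6) (pm_comp _ _ h).
Qed.

Lemma interleaved_trans (e1 e2 : R) M N P : 0 <= e1 -> 0 <= e2 ->
  interleaved e1 M N -> interleaved e2 N P -> interleaved (e1 + e2) M P.
Proof.
move=> e10 e20 [f [g fg]] [f' [g' fg']].
have [phi phiE] := hom_shift_comp f f' (erefl (e1 + e2)).
have [psi psiE] := hom_shift_comp g' g (addrC e2 e1).
exists phi, psi; split=> r h v.
- exact: (interleaving_comp e10 e20 erefl fg fg').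
- have gf : interleaving g f by case: fg.
  have gf' : interleaving g' f' by case: fg'.
  exact: (interleaving_comp e20 e10 (addrC e1 e2) gf' gf).
Qed.

Lemma d_I_ltP M N (e : R) :
  (d_I M N < e%:E)%E <->
  exists e' : R, [/\ 0 <= e', e' < e & interleaved e' M N].
Proof.
split=> [/ereal_inf_lt[_ [e' [e'0 MN] <-]]|[e' [e'0 e'e MN]]].
  by rewrite lte_fin => e'e; exists e'.
by apply: (@le_lt_trans _ _ e'%:E) => //; apply: ereal_inf_lbound; exists e'.
Qed.

Definition I_ball (X : Interleaving k R) (e : R) : set (Interleaving k R) :=
  [set Y | (d_I (Sp_mod k X) (Sp_mod k Y) < e%:E)%E].

Lemma I_ball_center X (e : R) : 0 < e -> I_ball X e X.
Proof.
by move=> e0; apply/d_I_ltP; exists 0; split=> //; exact: interleaved_refl.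
Qed.

Lemma I_ball_sym X Y (e : R) : I_ball X e Y -> I_ball Y e X.
Proof.
move=> /d_I_ltP[e' [e'0 e'e /interleaved_sym XY]].
by apply/d_I_ltP; exists e'.
Qed.

Lemma I_ball_triangle X Y Z (e1 e2 : R) :
  I_ball X e1 Y -> I_ball Y e2 Z -> I_ball X (e1 + e2) Z.
Proof.
move=> /d_I_ltP[a [a0 ae XY]] /d_I_ltP[b [b0 be YZ]].
apply/d_I_ltP; exists (a + b); split; [exact: addr_ge0|exact: ltrD|].
exact: interleaved_trans XY YZ.
Qed.

Lemma I_nbhsE : nbhs_ball_ I_ball = nbhs_ (entourage_ I_ball).
Proof.
rewrite predeq2E => X P; split=> [[e e0 XP]|[A [e e0 eA] AP]].
  exists [set xy | I_ball xy.1 e xy.2]; first by exists e.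
  by move=> Y /xsectionP/XP.
by exists e => // Y XY; apply: AP; apply/xsectionP; exact: eA.
Qed.

HB.instance Definition _ := Choice.on (Interleaving k R).
HB.instance Definition _ := hasNbhs.Build (Interleaving k R) (nbhs_ball_ I_ball).
HB.instance Definition _ := @Nbhs_isPseudoMetric.Build R (Interleaving k R)
  (entourage_ I_ball) I_nbhsE I_ball I_ball_center I_ball_sym I_ball_triangle
  erefl.

End InterleavingDistance.

(* Main.v *)
Require Import Defs.
From mathcomp Require Import all_boot all_order all_algebra.
From mathcomp Require Import all_classical all_reals all_analysis.

(** Let [X] be [k_(-oo,x)] or [k_(-oo,x]].  The injectives that receive a
    nonzero map from the finitely presented [k_[x-d,x+d)] form a Ziegler open
    neighbourhood of [X], and the right endpoint of each of them lies in
    [[x-d,x+d]].  Two lower intervals whose endpoints differ by less than [e]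
    are [e]-interleaved. *)

Import Order.TTheory GRing.Theory Num.Theory.

Local Open Scope classical_set_scope.
Local Open Scope ring_scope.

Section Neighbourhoods.
Set Implicit Arguments.
Unset Strict Implicit.
Variables (k : fieldType) (R : realType).

(** The one module [kint k (Interval (BLeft a) b)] witnesses openness at every point, being left
    orthogonal to the whole complement. *)
Lemma ziegler_open_itv (a : R) (b : itv_bound R) :
  bnd_right b -> (BLeft a < b)%O ->
  ziegler_open k [set X : Sp R | a \in Sp_itv X /\ (Sp_bound X <= b)%O].
Proof.
move=> br ab; apply/ziegler_openP => X [aX Xb].
exists (kint k (Interval (BLeft a) b)); last exact: hom_kint_Sp.
split; first exact: fp_kint.
by move=> Y; apply: contra_notP => /(hom_kint_SpP br).
Qed.

(** Shifting by [e] translates the interval of [Y] by [- e]; the hypothesis puts the result inside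
    that of [X], and the map is the canonical projection between lower intervals. *)
Lemma hom_Sp_shift (e : R) (X Y : Sp R) :
  (forall r, r + e \in Sp_itv Y -> r \in Sp_itv X) ->
  exists f : Defs.hom (Sp_mod k X) (Defs.shift e (Sp_mod k Y)),
    forall r v, f r v = fib_map (r + e \in Sp_itv Y) v.
Proof.
move=> YX.
suff nat r s (h : r <= s) (v : Sp_mod k X r) :
    @fib_map k (s \in Sp_itv X) (s + e \in Sp_itv Y) (pm_map h v) =
    pm_map h (@fib_map k (r \in Sp_itv X) (r + e \in Sp_itv Y) v
      : Defs.shift e (Sp_mod k Y) r).
  by exists (@Defs.Hom k R (Sp_mod k X) (Defs.shift e (Sp_mod k Y))
    (fun r => @fib_map k (r \in Sp_itv X) (r + e \in Sp_itv Y))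
    (fun r => @fib_map_linear k _ _) nat).
rewrite /= !fib_map_comp // => _; last exact: YX.
by apply: Sp_down; rewrite lerD2r.
Qed.

Lemma interleaved_Sp (e : R) (X Y : Sp R) :
  (forall r, r + e \in Sp_itv Y -> r \in Sp_itv X) ->
  (forall r, r + e \in Sp_itv X -> r \in Sp_itv Y) ->
  interleaved e (Sp_mod k X) (Sp_mod k Y).
Proof.
move=> YX XY; have [f fE] := hom_Sp_shift YX; have [g gE] := hom_Sp_shift XY.
exists f, g; split=> r h v.
(* The composite is the canonical map because the middle fibre is nonzero whenever the target fibre
   is. *)
- by rewrite /= fE gE fib_map_comp // => _; exact: XY.
- by rewrite /= fE gE fib_map_comp // => _; exact: YX.
Qed.

(** The strict [d < e] absorbs the difference between open and closed endpoints. *)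
Lemma interleaved_Sp_bound (x d e : R) (X Y : Sp R) : d < e ->
  (BLeft x <= Sp_bound X <= BRight x)%O ->
  (BLeft (x - d) <= Sp_bound Y <= BRight (x + d))%O ->
  interleaved e (Sp_mod k X) (Sp_mod k Y).
Proof.
move=> de /andP[xX Xx] /andP[xY Yx]; apply: interleaved_Sp => r; rewrite !in_Sp.
- move=> /le_trans/(_ Yx); rewrite bnd_simp => rxd.
  apply: le_trans xX; rewrite bnd_simp -(ltrD2r e).
  by rewrite (le_lt_trans rxd) // ltrD2l.
- move=> /le_trans/(_ Xx); rewrite bnd_simp => rx.
  apply: le_trans xY; rewrite bnd_simp.
  by rewrite (@le_lt_trans _ _ (x - e)) ?lerBrDr // ltrD2l ltrN2.
Qed.

(** This is where [SpFull] is excluded: its endpoint is infinite. *)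
Lemma Sp_bound_real (X : Sp R) : X <> SpFull ->
  exists x : R, (BLeft x <= Sp_bound X <= BRight x)%O.
Proof. by case: X => // x _; exists x; rewrite /= !bnd_simp. Qed.

End Neighbourhoods.

Theorem corollary8p3 (k : fieldType) (R : realType) :
  {within [set~ (SpFull : Ziegler k R)],
    continuous ((fun X => X) : Ziegler k R -> Interleaving k R)}.
Proof.
apply/subspace_continuousP => X /Sp_bound_real[x xX].
(* Continuity at [X] is shown for the full Ziegler topology, which is stronger. *)
apply: cvg_within_filter => U /nbhs_ballP[e /= e0 XeU].
(* Two strict gaps are needed: [d < e / 2] for the interleaving, [e / 2 < e] for the open ball. *)
have d0 : 0 < e / 2 / 2 by rewrite !divr_gt0.
set d := e / 2 / 2 in d0.
have [de ee] : d < e / 2 /\ e / 2 < e.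
  by split; rewrite ltr_pdivrMr // ltr_pMr ?divr_gt0 // ltr1n.
have [xX1 xX2] := andP xX.
rewrite nbhsE /=.
(* The bound is a [BLeft] so that the test module is half-open, hence finitely presented. *)
exists [set Y | x - d \in Sp_itv Y /\ (Sp_bound Y <= BLeft (x + d))%O].
  split; last first.
    split; first by rewrite in_Sp (le_trans _ xX1) // bnd_simp ltrBlDr ltrDl.
    by rewrite (le_trans xX2) // bnd_simp ltrDl.
  apply: ziegler_open_itv => //.
  by rewrite bnd_simp ltrD2l gtrN.
move=> Y [xY Yx]; apply: XeU; apply/d_I_ltP; exists (e / 2); split=> //.
  by rewrite divr_ge0 // ltW.
apply: interleaved_Sp_bound de xX _; apply/andP; split.
  by move: xY; rewrite in_Sp; apply: le_trans; rewrite bnd_simp.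
by rewrite (le_trans Yx) // bnd_simp.
Qed.
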